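(* Let $\Delta=\Delta(R_3)$ be the augmentation ideal of the integral quandle ring $\mathbb{Z}[R_3]$ of the dihedral quandle $R_3$. Then $$\Delta(R_3)^{2k+1}=\langle 3^kE_1,\;3^kE_2\rangle\quad\text{for all integers } k\ge 0,$$ and $$\Delta(R_3)^{2\ell}=\langle 3^{\ell-1}(E_1+E_2),\;3^{\ell}E_2\rangle\quad\text{for all integers }\ell\ge 1.$$
   Context: $R_3$ is the dihedral quandle: the set $\mathbb{Z}_3=\{0,1,2\}$ with operation $x*y=2y-x$ modulo $3$. The quandle ring $\mathbb{Z}[R_3]$ is the free $\mathbb{Z}$-module with basis $e_0,e_1,e_2$ and the bilinear (non-associative) product with $e_ie_j=e_{i*j}$. The augmentation map is $\varepsilon:\mathbb{Z}[R_3]\to\mathbb{Z}$, $\varepsilon(\sum\alpha_ie_i)=\sum\alpha_i$, and $\Delta(R_3)=\ker\varepsilon$ is the augmentation ideal. Put $E_i=e_i-e_0$ for $i=1,2$; these form a $\mathbb{Z}$-basis of $\Delta(R_3)$. Powers are defined by $\Delta^1=\Delta$ and $\Delta^{m+1}=\Delta^m\Delta$, where the product $IJ$ is the additive subgroup generated by all products $ab$ with $a\in I$, $b\in J$. $\langle\cdots\rangle$ denotes the $\mathbb{Z}$-span (additive subgroup generated). *)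

(* Defs.v *)
From HB Require Import structures.
From mathcomp Require Import all_boot all_order all_algebra.
From mathcomp Require Import boolp classical_sets.

Set Implicit Arguments.
Unset Strict Implicit.
Unset Printing Implicit Defensive.

Import GRing.Theory.
Local Open Scope ring_scope.
Local Open Scope classical_set_scope.

(* The dihedral quandle R_3: the set Z/3 with the operation i * j = 2 j - i. *)
Notation R3 := 'Z_3.

Definition R3op (i j : R3) : R3 := 2 * j - i.

(* The free Z-module on R_3. Only the additive structure of finite functions is
   inherited; the product of the quandle ring is [qmul] below, not the pointwise
   one. *)
Definition ZR3 : Type := {ffun R3 -> int}.
HB.instance Definition _ := GRing.Zmodule.on ZR3.

Definition e (i : R3) : ZR3 := [ffun j => (j == i)%:R].

(* Bilinear extension of e_i e_j = e_{i * j}. *)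
Definition qmul (a b : ZR3) : ZR3 :=
  \sum_(i : R3) \sum_(j : R3) e (R3op i j) *~ (a i * b j).

Definition augmentation (a : ZR3) : int := \sum_(i : R3) a i.

Definition Delta : set ZR3 := [set a | augmentation a = 0].

Definition E (i : R3) : ZR3 := e i - e 0.

Definition additive_subgroup (A : set ZR3) : Prop := zmod_closed (mem A).

Definition zspan (G : set ZR3) : set ZR3 := smallest additive_subgroup G.

Definition setmul (I J : set ZR3) : set ZR3 :=
  zspan [set c | exists a b, [/\ I a, J b & c = qmul a b]].

(* [Delta_pow m] is the m-th power for m >= 1: Delta_pow 1 is Delta, and
   Delta_pow m.+1 is (Delta_pow m) Delta. The value at 0 is a dummy. *)
Definition Delta_pow (m : nat) : set ZR3 :=
  iter m.-1 (fun I => setmul I Delta) Delta.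

(* Main.v *)
Require Import Defs.
From mathcomp Require Import all_boot all_order all_algebra.
From mathcomp Require Import boolp classical_sets.
From mathcomp Require Import ring.

(** The product of the quandle ring is biadditive, so if subgroups [I] and [J]
    are spanned by [G] and [H], then [IJ] is spanned by the products of a
    generator in [G] and a generator in [H] ([setmul_zspan]).  Since [Delta] is
    spanned by [E 1] and [E 2] ([Delta_zspan]), each further power of [Delta] is
    computed from the four products
      E1 E1 = E1 - 2 E2,   E1 E2 = E2 E1 = - E1 - E2,   E2 E2 = E2 - 2 E1.
    Each of them is congruent to a multiple of [E1 + E2] modulo [3 E2], so
    multiplying the span of [n E1, n E2] by [Delta] gives the span of
    [n (E1 + E2), 3n E2].  Next, (E1 + E2) E1 = - 3 E2 and
    (E1 + E2) E2 = - 3 E1, while the products of 3n E2 lie in 3n [Delta], so a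
    second multiplication by [Delta] gives the span of [3n E1, 3n E2].  Two
    steps thus return the original shape with [n] replaced by [3n], and both
    formulas follow by induction from [n = 1]. *)

Set Implicit Arguments.
Unset Strict Implicit.
Unset Printing Implicit Defensive.

Import GRing.Theory.
Local Open Scope ring_scope.
Local Open Scope classical_set_scope.

Lemma additive_subgroupP (A : set ZR3) :
  additive_subgroup A <-> A 0 /\ (forall x y, A x -> A y -> A (x - y)).
Proof.
split=> -[A0 AB]; split; first by rewrite inE in A0.
- by move=> x y Ax Ay; have := AB x y; rewrite !inE; apply.
- by rewrite inE.
- by move=> x y; rewrite !inE; apply: AB.
Qed.

Lemma zspan_subgroup (G : set ZR3) : additive_subgroup (zspan G).
Proof.
apply/additive_subgroupP; split=> [A [/additive_subgroupP[A0 _] _] //|].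
move=> x y Gx Gy A GA; have [/additive_subgroupP[_ AB] _] := GA.
by apply: AB; [apply: Gx | apply: Gy].
Qed.

Lemma sub_zspan (G : set ZR3) : G `<=` zspan G.
Proof. exact: sub_smallest. Qed.

Lemma zspan_min (G A : set ZR3) :
  additive_subgroup A -> G `<=` A -> zspan G `<=` A.
Proof. exact: smallest_sub. Qed.

Lemma zspan_eq (G H : set ZR3) :
  G `<=` zspan H -> H `<=` zspan G -> zspan G = zspan H.
Proof.
by move=> GH HG; apply/seteqP; split; apply: zspan_min => //;
  apply: zspan_subgroup.
Qed.

Lemma zspan_combination (G : set ZR3) (x y : ZR3) (m n : int) :
  zspan G x -> zspan G y -> zspan G (x *~ m + y *~ n).
Proof.
have [S0 SB] := (additive_subgroupP (zspan G)).1 (zspan_subgroup G).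
have SN u : zspan G u -> zspan G (- u) by rewrite -sub0r; apply: SB.
have SD u v : zspan G u -> zspan G v -> zspan G (u + v).
  by move=> Gu /SN Gv; rewrite -[v]opprK; apply: SB.
have SMn u k : zspan G u -> zspan G (u *+ k).
  by move=> Gu; elim: k => [|k IHk]; rewrite ?mulr0n // mulrS; apply: SD.
have SMz u k : zspan G u -> zspan G (u *~ k).
  case: k => k Gu; first by rewrite -pmulrn; apply: SMn.
  by rewrite NegzE mulrNz -pmulrn; apply: SN; apply: SMn.
by move=> Gx Gy; apply: SD; apply: SMz.
Qed.

Lemma zspan_pair_mem (x y z : ZR3) (m n : int) :
  z = x *~ m + y *~ n -> zspan [set x; y] z.
Proof.
by move->; apply: zspan_combination; apply: sub_zspan; [left | right].
Qed.

Lemma qmulBl (a a' b : ZR3) : qmul (a - a') b = qmul a b - qmul a' b.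
Proof.
rewrite /qmul -sumrB; apply: eq_bigr => i _; rewrite -sumrB.
by apply: eq_bigr => j _; rewrite !ffunE mulrBl mulrzBr.
Qed.

Lemma qmulBr (a b b' : ZR3) : qmul a (b - b') = qmul a b - qmul a b'.
Proof.
rewrite /qmul -sumrB; apply: eq_bigr => i _; rewrite -sumrB.
by apply: eq_bigr => j _; rewrite !ffunE mulrBr mulrzBr.
Qed.

Lemma qmul0l (b : ZR3) : qmul 0 b = 0.
Proof. by rewrite -(subrr 0) qmulBl !subrr. Qed.

Lemma qmul0r (a : ZR3) : qmul a 0 = 0.
Proof. by rewrite -(subrr 0) qmulBr !subrr. Qed.

Lemma qmulDl (a a' b : ZR3) : qmul (a + a') b = qmul a b + qmul a' b.
Proof.
by rewrite -[in LHS](opprK a') qmulBl -(sub0r a') qmulBl qmul0l sub0r opprK.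
Qed.

Lemma qmulMnl (a b : ZR3) (n : nat) : qmul (a *+ n) b = qmul a b *+ n.
Proof. by elim: n => [|n IHn]; rewrite ?qmul0l // !mulrS qmulDl IHn. Qed.

(** For a fixed subgroup [S], the elements [a] with [ab] in [S] form a subgroup,
    and so do the elements [b]; hence it suffices to test [ab] in [S] on
    generators, first in [a] and then in [b]. *)
Lemma setmul_zspan (G H : set ZR3) :
  setmul (zspan G) (zspan H) =
  zspan [set c | exists a b, [/\ G a, H b & c = qmul a b]].
Proof.
apply: zspan_eq; last first.
  move=> _ [a [b [Ga Hb ->]]]; apply: sub_zspan; exists a, b.
  by split=> //; apply: sub_zspan.
set S := zspan [set c | _].
have [S0 SB] := (additive_subgroupP S).1 (zspan_subgroup _).
move=> _ [a [b [Ga Hb ->]]].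
have SGr g : G g -> S (qmul g b).
  move=> Gg; apply: (zspan_min (A := [set x | S (qmul g x)]) _ _ Hb).
    apply/additive_subgroupP; split=> /= [|x y]; first by rewrite qmul0r.
    by rewrite qmulBr; apply: SB.
  by move=> h Hh; apply: sub_zspan; exists g, h.
apply: (zspan_min (A := [set x | S (qmul x b)]) _ _ Ga) => //.
apply/additive_subgroupP; split=> /= [|x y]; first by rewrite qmul0l.
by rewrite qmulBl; apply: SB.
Qed.

Lemma qmul_e (i j : R3) : qmul (e i) (e j) = e (R3op i j).
Proof.
rewrite /qmul (bigD1 i) //= (bigD1 j) //= !ffunE !eqxx.
rewrite big1 => [|k /negPf kj]; last first.
  by rewrite !ffunE kj mulr0 mulr0z.
rewrite big1 ?addr0 ?mulr1 // => k /negPf ki; rewrite big1 // => l _.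
by rewrite !ffunE ki mul0r mulr0z.
Qed.

Lemma qmul_E (i j : R3) :
  qmul (E i) (E j) = e (R3op i j) - e (R3op i 0) - (e (R3op 0 j) - e 0).
Proof.
rewrite /E qmulBl !qmulBr !qmul_e.
by rewrite [R3op 0 0](_ : _ = 0) //; apply/val_inj.
Qed.

Lemma qmul_E11 : qmul (E 1) (E 1) = E 1 - E 2 *+ 2.
Proof.
rewrite qmul_E [R3op 1 1](_ : _ = 1); last exact/val_inj.
rewrite [R3op 1 0](_ : _ = 2); last exact/val_inj.
rewrite [R3op 0 1](_ : _ = 2); last exact/val_inj.
by apply/ffunP => x; rewrite !(ffunE, ffunMnE); ring.
Qed.

Lemma qmul_E12 : qmul (E 1) (E 2) = - E 1 - E 2.
Proof.
rewrite qmul_E [R3op 1 2](_ : _ = 0); last exact/val_inj.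
rewrite [R3op 1 0](_ : _ = 2); last exact/val_inj.
rewrite [R3op 0 2](_ : _ = 1); last exact/val_inj.
by apply/ffunP => x; rewrite !(ffunE, ffunMnE); ring.
Qed.

Lemma qmul_E21 : qmul (E 2) (E 1) = - E 1 - E 2.
Proof.
rewrite qmul_E [R3op 2 1](_ : _ = 0); last exact/val_inj.
rewrite [R3op 2 0](_ : _ = 1); last exact/val_inj.
rewrite [R3op 0 1](_ : _ = 2); last exact/val_inj.
by apply/ffunP => x; rewrite !(ffunE, ffunMnE); ring.
Qed.

Lemma qmul_E22 : qmul (E 2) (E 2) = E 2 - E 1 *+ 2.
Proof.
rewrite qmul_E [R3op 2 2](_ : _ = 2); last exact/val_inj.
rewrite [R3op 2 0](_ : _ = 1); last exact/val_inj.
rewrite [R3op 0 2](_ : _ = 1); last exact/val_inj.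
by apply/ffunP => x; rewrite !(ffunE, ffunMnE); ring.
Qed.

Lemma augmentationE (a : ZR3) : augmentation a = a 0 + a 1 + a 2.
Proof.
rewrite /augmentation !big_ord_recl big_ord0 addr0 addrA.
by congr (a _ + a _ + a _); apply/val_inj.
Qed.

Lemma Delta_zspan : Delta = zspan [set E 1; E 2].
Proof.
apply/seteqP; split=> [a|].
  rewrite /Delta /= augmentationE => a0.
  (* [e 1] occurs only in [E 1] and [e 2] only in [E 2]; the coefficient of
     [e 0] is then forced by the vanishing of the augmentation. *)
  apply: (zspan_pair_mem (m := a 1) (n := a 2)).
  have a0E : a 0 = - a 1 - a 2 by rewrite -[LHS]subr0 -a0; ring.
  apply/ffunP => x; rewrite !(ffunE, ffunMzE).
  have [->|->|->] : [\/ x = 0, x = 1 | x = 2].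
    by case: x => -[|[|[|]]] // ?;
      [apply: Or31 | apply: Or32 | apply: Or33]; apply/val_inj.
  - by rewrite a0E /=; ring.
  - by rewrite /=; ring.
  - by rewrite /=; ring.
apply: zspan_min => [|_ [] ->]; rewrite /Delta /=.
- apply/additive_subgroupP; split=> /= [|x y].
    by rewrite augmentationE !ffunE.
  rewrite !augmentationE !ffunE => x0 y0.
  by rewrite -[RHS](subrr 0) -{1}x0 -y0; ring.
- by rewrite augmentationE !ffunE.
- by rewrite augmentationE !ffunE.
Qed.

Lemma setmul_pair_Delta (x y : ZR3) :
  setmul (zspan [set x; y]) Delta =
  zspan ([set qmul x (E 1); qmul x (E 2)] `|`
         [set qmul y (E 1); qmul y (E 2)]).
Proof.
rewrite Delta_zspan setmul_zspan; congr zspan; apply/seteqP; split=> c.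
  by case=> a [b [[] -> [] -> ->]]; [left; left | left; right
    | right; left | right; right].
by case=> -[] ->; [exists x, (E 1) | exists x, (E 2)
  | exists y, (E 1) | exists y, (E 2)]; split=> //; (by left) || by right.
Qed.

(** From an odd power to the next even one.  The generators are recovered as
    n (E1 + E2) = - (n E1) E2 and 3n E2 = - (n E1) E1 - (n E1) E2. *)
Lemma setmul_odd_Delta (n : nat) :
  setmul (zspan [set E 1 *+ n; E 2 *+ n]) Delta =
  zspan [set (E 1 + E 2) *+ n; E 2 *+ (3 * n)].
Proof.
rewrite setmul_pair_Delta !qmulMnl qmul_E11 qmul_E12.
rewrite qmul_E21 qmul_E22.
apply: zspan_eq => [_ [[] ->|[] ->]|_ [] ->].
- apply: (zspan_pair_mem (m := 1) (n := -1)).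
  by apply/ffunP => x; rewrite !(ffunE, ffunMnE, ffunMzE); ring.
- apply: (zspan_pair_mem (m := -1) (n := 0)).
  by apply/ffunP => x; rewrite !(ffunE, ffunMnE, ffunMzE); ring.
- apply: (zspan_pair_mem (m := -1) (n := 0)).
  by apply/ffunP => x; rewrite !(ffunE, ffunMnE, ffunMzE); ring.
- apply: (zspan_pair_mem (m := -2) (n := 1)).
  by apply/ffunP => x; rewrite !(ffunE, ffunMnE, ffunMzE); ring.
- rewrite [X in zspan _ X](_ : _ =
    (E 1 - E 2 *+ 2) *+ n *~ 0 + (- E 1 - E 2) *+ n *~ -1).
    by apply: zspan_combination; apply: sub_zspan; left; [left | right].
  by apply/ffunP => x; rewrite !(ffunE, ffunMnE, ffunMzE); ring.
- rewrite [X in zspan _ X](_ : _ =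
    (E 1 - E 2 *+ 2) *+ n *~ -1 + (- E 1 - E 2) *+ n *~ -1).
    by apply: zspan_combination; apply: sub_zspan; left; [left | right].
  by apply/ffunP => x; rewrite !(ffunE, ffunMnE, ffunMzE); ring.
Qed.

(** From an even power to the next odd one.  The generators are recovered as
    3n E1 = - n (E1 + E2) E2 and 3n E2 = - n (E1 + E2) E1. *)
Lemma setmul_even_Delta (n : nat) :
  setmul (zspan [set (E 1 + E 2) *+ n; E 2 *+ (3 * n)]) Delta =
  zspan [set E 1 *+ (3 * n); E 2 *+ (3 * n)].
Proof.
rewrite setmul_pair_Delta !qmulMnl !(qmulDl (E 1) (E 2)) qmul_E11 qmul_E12.
rewrite qmul_E21 qmul_E22.
apply: zspan_eq => [_ [[] ->|[] ->]|_ [] ->].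
- apply: (zspan_pair_mem (m := 0) (n := -1)).
  by apply/ffunP => x; rewrite !(ffunE, ffunMnE, ffunMzE); ring.
- apply: (zspan_pair_mem (m := -1) (n := 0)).
  by apply/ffunP => x; rewrite !(ffunE, ffunMnE, ffunMzE); ring.
- apply: (zspan_pair_mem (m := -1) (n := -1)).
  by apply/ffunP => x; rewrite !(ffunE, ffunMnE, ffunMzE); ring.
- apply: (zspan_pair_mem (m := -2) (n := 1)).
  by apply/ffunP => x; rewrite !(ffunE, ffunMnE, ffunMzE); ring.
- rewrite [X in zspan _ X](_ : _ =
    (E 1 - E 2 *+ 2 + (- E 1 - E 2)) *+ n *~ 0 +
    (- E 1 - E 2 + (E 2 - E 1 *+ 2)) *+ n *~ -1).
    by apply: zspan_combination; apply: sub_zspan; left; [left | right].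
  by apply/ffunP => x; rewrite !(ffunE, ffunMnE, ffunMzE); ring.
- rewrite [X in zspan _ X](_ : _ =
    (E 1 - E 2 *+ 2 + (- E 1 - E 2)) *+ n *~ -1 +
    (- E 1 - E 2 + (E 2 - E 1 *+ 2)) *+ n *~ 0).
    by apply: zspan_combination; apply: sub_zspan; left; [left | right].
  by apply/ffunP => x; rewrite !(ffunE, ffunMnE, ffunMzE); ring.
Qed.

Lemma Delta_powS (m : nat) :
  (0 < m)%N -> Delta_pow m.+1 = setmul (Delta_pow m) Delta.
Proof. by case: m. Qed.

Theorem proposition4p2 :
  (forall k : nat,
     Delta_pow (2 * k + 1) =
     zspan [set E 1 *+ (3 ^ k)%N; E 2 *+ (3 ^ k)%N]) /\
  (forall l : nat, (1 <= l)%N ->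
     Delta_pow (2 * l) =
     zspan [set (E 1 + E 2) *+ (3 ^ (l - 1))%N; E 2 *+ (3 ^ l)%N]).
Proof.
have step k :
    Delta_pow (2 * k + 1) = zspan [set E 1 *+ (3 ^ k)%N; E 2 *+ (3 ^ k)%N] ->
    Delta_pow (2 * k.+1) =
    zspan [set (E 1 + E 2) *+ (3 ^ k)%N; E 2 *+ (3 ^ k.+1)%N].
  move=> odd_k; rewrite expnS -setmul_odd_Delta -odd_k -Delta_powS ?addn1 //.
  by rewrite mulnS addnC addn2.
have odd k :
    Delta_pow (2 * k + 1) = zspan [set E 1 *+ (3 ^ k)%N; E 2 *+ (3 ^ k)%N].
  elim: k => [|k /step even_k]; first by rewrite !mulr1n -Delta_zspan.
  by rewrite addn1 Delta_powS // even_k expnS setmul_even_Delta.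
split=> // -[//|l] _; rewrite subn1 /=; exact: step.
Qed.
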